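(* Let $\Sigma$ be a plural signature. There exists a natural isomorphism $\theta$ from the functor $P\circ \mathrm{P\text{\l}}_{\Sigma}$ to the functor $Q\circ\mathfrak{L}_{\Sigma}\circ\int^{G}\eta$, where $\mathrm{P\text{\l}}_{\Sigma}\colon\int^{\mathsf{Sl}_{\mathsf{s}}}\mathrm{Isys}_{\Sigma}\to\mathsf{P\text{\l}Alg}(\Sigma)_{\mathsf{s}}$ is the (birestricted) Płonka functor, $P\colon\mathsf{P\text{\l}Alg}(\Sigma)_{\mathsf{s}}\to\mathsf{Alg}(\Sigma)_{\mathsf{s}}$, $\int^{G}\eta\colon\int^{\mathsf{Sl}_{\mathsf{s}}}\mathrm{Isys}_{\Sigma}\to\int^{\mathsf{NPIAlg}(\Sigma)_{\mathsf{s}}}\mathrm{Lsys}_{\Sigma}$, $\mathfrak{L}_{\Sigma}\colon\int^{\mathsf{NPIAlg}(\Sigma)_{\mathsf{s}}}\mathrm{Lsys}_{\Sigma}\to\int_{\mathsf{NPIAlg}(\Sigma)_{\mathsf{s}}}(\mathsf{Alg}(\Sigma)\downarrow_{\mathsf{s}}\cdot)$ is the Lallement functor, and $Q\colon\int_{\mathsf{NPIAlg}(\Sigma)_{\mathsf{s}}}(\mathsf{Alg}(\Sigma)\downarrow_{\mathsf{s}}\cdot)\to\mathsf{Alg}(\Sigma)_{\mathsf{s}}$.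
   Context: A signature is a family $\Sigma=(\Sigma_n)_{n\in\mathbb{N}}$ of sets of $n$-ary operation symbols; it is plural if $\Sigma_0=\varnothing$ and $\Sigma_n\neq\varnothing$ for some $n\geq 2$. We write $n=\{0,\dots,n-1\}$. All $\Sigma$-algebras and semilattices are non-empty. $\mathsf{Alg}(\Sigma)$ is the category of $\Sigma$-algebras and homomorphisms; $\mathsf{Alg}(\Sigma)_{\mathsf{s}}$ has the same objects and the surjective homomorphisms as morphisms. **Semilattice inductive systems.** A semilattice is a poset $\mathbf{I}=(I,\leq)$ with binary joins; morphisms preserve binary joins; $\mathsf{Sl}$ is the category of semilattices and $\mathsf{Sl}_{\mathsf{s}}$ the category of semilattices and surjective morphisms. An $\mathbf{I}$-inductive system of $\Sigma$-algebras is $\mathcal{A}=((\mathbf{A}_i)_{i\in I},(f_{i,j})_{i\leq j})$ with homomorphisms $f_{i,j}\colon\mathbf{A}_i\to\mathbf{A}_j$, $f_{i,i}=\mathrm{id}$, $f_{j,k}\circ f_{i,j}=f_{i,k}$ (a functor $\mathbf{I}\to\mathsf{Alg}(\Sigma)$); morphisms are natural transformations. For $\xi\colon\mathbf{I}\to\mathbf{P}$ and a $\mathbf{P}$-inductive system $\mathcal{B}=((\mathbf{B}_p)_{p\in P},(g_{p,q})_{p\leq q})$, put $\mathcal{B}_\xi=((\mathbf{B}_{\xi(i)})_{i\in I},(g_{\xi(i),\xi(j)})_{i\leq j})$. The category $\int^{\mathsf{Sl}}\mathrm{Isys}_\Sigma$ has objects $\boldsymbol{\mathcal{A}}=(\mathbf{I},\mathcal{A})$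 with $\mathbf{I}$ a semilattice and $\mathcal{A}$ an $\mathbf{I}$-inductive system; a morphism $(\mathbf{I},\mathcal{A})\to(\mathbf{P},\mathcal{B})$ is a pair $(\xi,u)$ with $\xi\colon\mathbf{I}\to\mathbf{P}$ a morphism of semilattices and $u=(u_i)_{i\in I}\colon\mathcal{A}\to\mathcal{B}_\xi$ a morphism; $(\zeta,v)\circ(\xi,u)=(\zeta\circ\xi,(v_{\xi(i)}\circ u_i)_{i\in I})$. The category $\int^{\mathsf{Sl}_{\mathsf{s}}}\mathrm{Isys}_\Sigma$ is defined in the same way, but with $\xi$ surjective. **Płonka functor and $P$.** A Płonka $\Sigma$-algebra is a pair $(\mathbf{A},D)$ with $\mathbf{A}$ a $\Sigma$-algebra and $D$ a binary operation on $A$ with $D(x,x)=x$, $D(x,D(y,z))=D(D(x,y),z)$, $D(x,D(y,z))=D(x,D(z,y))$, $D(F^{\mathbf{A}}_\sigma((x_j)_{j\in n}),y)=F^{\mathbf{A}}_\sigma((D(x_j,y))_{j\in n})$, $D(y,F^{\mathbf{A}}_\sigma((x_j)_{j\in n}))=D(y,D_n((x_j)_{j\in n}))$, for all $n\geq 1$ and $\sigma\in\Sigma_n$, where $D_n$ is the $n$-fold iterate of $D$ ($D_1(x)=x$, $D_{n+1}(x_0,\dots,x_n)=D(D_n(x_0,\dots,x_{n-1}),x_n)$). A morphism $h\colon(\mathbf{A},D)\to(\mathbf{B},E)$ is a homomorphism $h\colon\mathbf{A}\to\mathbf{B}$ with $E\circ(h\times h)=h\circ D$. $\mathsf{P\text{\l}Alg}(\Sigma)$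 is the resulting category and $\mathsf{P\text{\l}Alg}(\Sigma)_{\mathsf{s}}$ its subcategory with all objects and with the surjective homomorphisms between Płonka algebras as morphisms. The relation $\Phi^D=\{(x,y)\mid D(x,y)=x,\ D(y,x)=y\}$ is a congruence on $\mathbf{A}$ compatible with $D$. The Płonka functor $\mathrm{P\text{\l}}_\Sigma\colon\int^{\mathsf{Sl}}\mathrm{Isys}_\Sigma\to\mathsf{P\text{\l}Alg}(\Sigma)$ sends $\boldsymbol{\mathcal{A}}=(\mathbf{I},\mathcal{A})$ to $(\mathbf{P\text{\l}}_\Sigma(\boldsymbol{\mathcal{A}}),D^{\boldsymbol{\mathcal{A}}})$, where $\mathbf{P\text{\l}}_\Sigma(\boldsymbol{\mathcal{A}})$ (the Płonka sum) has underlying set $\bigcup_{i\in I}(A_i\times\{i\})$, operations $F_\sigma((x_j,i_j)_{j\in n})=(F^{\mathbf{A}_i}_\sigma((f_{i_j,i}(x_j))_{j\in n}),i)$ with $i=\bigvee_{j\in n}i_j$, and $D^{\boldsymbol{\mathcal{A}}}((x,j),(y,k))=(f_{j,j\vee k}(x),j\vee k)$; it sends $(\xi,u)$ to $(x,i)\mapsto(u_i(x),\xi(i))$. In the claim, $\mathrm{P\text{\l}}_\Sigma$ denotes the birestriction of this functor to $\int^{\mathsf{Sl}_{\mathsf{s}}}\mathrm{Isys}_\Sigma$ and $\mathsf{P\text{\l}Alg}(\Sigma)_{\mathsf{s}}$. $P\colon\mathsf{P\text{\l}Alg}(\Sigma)_{\mathsf{s}}\to\mathsf{Alg}(\Sigma)_{\mathsf{s}}$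 is the functor that sends $(\mathbf{A},D)$ to $\mathbf{A}/\Phi^D$ and a morphism $h$ to the induced homomorphism $[x]\mapsto[h(x)]$ between quotients. **Lallement functor.** For a $\Sigma$-algebra $\mathbf{I}$, $\leq_{\mathbf{I}}$ is the reflexive transitive closure of the relation: $b\prec_{\mathbf{I}}a$ iff $a=F^{\mathbf{I}}_\sigma((a_j)_{j\in n})$ for some $n\geq1$, $\sigma\in\Sigma_n$, with $b=a_j$ for some $j$. $\mathbf{I}$ is npi (naturally preordered idempotent) if it is idempotent ($F^{\mathbf{I}}_\sigma(i,\dots,i)=i$) and all $F^{\mathbf{I}}_\sigma$ are isotone for $\leq_{\mathbf{I}}$. $\mathsf{NPIAlg}(\Sigma)_{\mathsf{s}}$: npi $\Sigma$-algebras and surjective homomorphisms. An $\mathbf{I}$-semi-inductive Lallement system is $((\mathbf{A}_i,\mathbf{M}_i)_{i\in I},(f_{i,j})_{i\leq_{\mathbf{I}}j})$ with $\mathbf{A}_i$ a subalgebra of $\mathbf{M}_i$ and homomorphisms $f_{i,j}\colon\mathbf{A}_i\to\mathbf{M}_j$ such that, for $i=F^{\mathbf{I}}_\sigma((i_k)_{k\in n})$ and $a_k\in A_{i_k}$: $F^{\mathbf{M}_i}_\sigma((f_{i_k,i}(a_k))_{k\in n})\in A_i$; $f_{i,j}(F^{\mathbf{M}_i}_\sigma((f_{i_k,i}(a_k))_{k\in n}))=F^{\mathbf{M}_j}_\sigma((f_{i_k,j}(a_k))_{k\in n})$ whenever $i\leq_{\mathbf{I}}j$; and $f_{i,i}$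 is the inclusion. A morphism $u$ to $((\mathbf{B}_i,\mathbf{N}_i)_{i},(g_{i,j}))$ is a family of homomorphisms $u_i\colon\mathbf{M}_i\to\mathbf{N}_i$ with $u_i[A_i]\subseteq B_i$ and $u_j\circ f_{i,j}=g_{i,j}\circ u_i|_{A_i}$. $\int^{\mathsf{NPIAlg}(\Sigma)_{\mathsf{s}}}\mathrm{Lsys}_\Sigma$ has objects $(\mathbf{I},\mathcal{A})$ with $\mathbf{I}$ npi and $\mathcal{A}$ an $\mathbf{I}$-semi-inductive Lallement system, and morphisms $(t,u)\colon(\mathbf{I},\mathcal{A})\to(\mathbf{P},\mathcal{B})$ with $t\colon\mathbf{I}\to\mathbf{P}$ a surjective homomorphism and $u\colon\mathcal{A}\to\mathcal{B}_t$ a morphism, where $\mathcal{B}_t$ is $\mathcal{B}$ reindexed along $t$. $\int_{\mathsf{NPIAlg}(\Sigma)_{\mathsf{s}}}(\mathsf{Alg}(\Sigma)\downarrow_{\mathsf{s}}\cdot)$ has objects $(\mathbf{I},(\mathbf{A},f))$ with $\mathbf{I}$ npi and $f\colon\mathbf{A}\to\mathbf{I}$ a surjective homomorphism, and morphisms $(t,h)\colon(\mathbf{I},(\mathbf{A},f))\to(\mathbf{P},(\mathbf{B},g))$ with $t\colon\mathbf{I}\to\mathbf{P}$ a surjective homomorphism, $h\colon\mathbf{A}\to\mathbf{B}$ a homomorphism, $t\circ f=g\circ h$. The Lallement functor $\mathfrak{L}_\Sigma$ sends $(\mathbf{I},\mathcal{A})$ to $(\mathbf{I},(\boldsymbol{\mathfrak{L}},\mathrm{p}))$,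 where $\boldsymbol{\mathfrak{L}}$ (the Lallement sum) has underlying set $\bigcup_{i\in I}(A_i\times\{i\})$, operations $F_\sigma((a_k,i_k)_{k\in n})=(F^{\mathbf{M}_i}_\sigma((f_{i_k,i}(a_k))_{k\in n}),i)$ with $i=F^{\mathbf{I}}_\sigma((i_k)_{k\in n})$, and $\mathrm{p}(a,i)=i$; it sends $(t,u)$ to $(t,u^t)$ with $u^t(a,i)=(u_i(a),t(i))$. **The functors $G$, $\int^G\eta$, $Q$.** $G\colon\mathsf{Sl}_{\mathsf{s}}\to\mathsf{NPIAlg}(\Sigma)_{\mathsf{s}}$ sends a semilattice $\mathbf{I}$ to the npi $\Sigma$-algebra on $I$ with $F_\sigma((i_k)_{k\in n})=\bigvee_{k\in n}i_k$ (for which $\leq_{G(\mathbf{I})}$ is $\leq$) and a morphism to the same underlying map. $\int^G\eta$ sends $(\mathbf{I},((\mathbf{A}_i)_{i},(f_{i,j})))$ to $(G(\mathbf{I}),((\mathbf{A}_i,\mathbf{A}_i)_{i},(f_{i,j})))$ and $(\xi,u)$ to $(G(\xi),u)$. $Q$ sends $(\mathbf{I},(\mathbf{A},f))$ to $\mathbf{I}$ and $(t,h)$ to $t$.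
   Formalization: As Pł(ξ,u) need not be surjective for surjective ξ, the claim is proved on the whole domain with PłAlg_s enlarged to morphisms inducing surjections on quotients by Φ^D, and with PłAlg_s itself on the morphisms that Pł sends to surjective ones. *)

(* Defs.v *)
From HB Require Import structures.
From mathcomp Require Import all_boot all_order generic_quotient.
From mathcomp Require Import boolp.
From Stdlib Require Import Relation_Operators.

Set Implicit Arguments.
Unset Strict Implicit.
Unset Printing Implicit Defensive.

Import Order.TTheory.

Record category := Category {
  obj :> Type;
  arr : obj -> obj -> Type;
  idc : forall X, arr X X;
  comp : forall X Y Z, arr Y Z -> arr X Y -> arr X Z;
  comp_idl : forall X Y (f : arr X Y), comp (idc Y) f = f;
  comp_idr : forall X Y (f : arr X Y), comp f (idc X) = f;
  comp_assoc : forall X Y Z T (f : arr X Y) (g : arr Y Z) (h : arr Z T),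
    comp h (comp g f) = comp (comp h g) f }.

Arguments arr [c] X Y.
Arguments idc [c] X.
Arguments comp [c X Y Z] g f.

Record functor (C D : category) := Functor {
  fobj :> C -> D;
  farr : forall X Y, arr X Y -> arr (fobj X) (fobj Y);
  farr_id : forall X, farr (idc X) = idc (fobj X);
  farr_comp : forall X Y Z (g : arr Y Z) (f : arr X Y),
    farr (comp g f) = comp (farr g) (farr f) }.

Arguments farr [C D] F [X Y] f : rename.

Section FunctorComp.
Context (C D E : category) (G : functor D E) (F : functor C D).

Lemma functor_comp_id X : farr G (farr F (idc X)) = idc (G (F X)).
Proof. by rewrite !farr_id. Qed.

Lemma functor_comp_comp X Y Z (g : arr Y Z) (f : arr X Y) :
  farr G (farr F (comp g f)) = comp (farr G (farr F g)) (farr G (farr F f)).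
Proof. by rewrite !farr_comp. Qed.

Definition functor_comp : functor C E :=
  Functor functor_comp_id functor_comp_comp.

End FunctorComp.

Notation "G \oF F" := (functor_comp G F) (at level 50, left associativity).

Record nat_trans (C D : category) (F G : functor C D) := NatTrans {
  nt_comp :> forall X : C, arr (F X) (G X);
  nt_natural : forall (X Y : C) (f : arr X Y),
    comp (nt_comp Y) (farr F f) = comp (farr G f) (nt_comp X) }.

Definition is_iso (C : category) (X Y : C) (f : arr X Y) : Prop :=
  exists g : arr Y X, comp g f = idc X /\ comp f g = idc Y.

Definition is_nat_iso (C D : category) (F G : functor C D)
    (theta : nat_trans F G) : Prop :=
  forall X : C, is_iso (theta X).

(* A class of morphisms defining a wide subcategory (one with all objects). *)
Record arr_class (C : category) := ArrClass {
  in_class :> forall X Y : C, arr X Y -> Prop;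
  in_class_id : forall X : C, in_class (idc X);
  in_class_comp : forall (X Y Z : C) (g : arr Y Z) (f : arr X Y),
    in_class g -> in_class f -> in_class (comp g f) }.

Arguments in_class [C] W [X Y] f : rename.

Lemma sig_val_inj (T : Type) (P : T -> Prop) (x y : {a : T | P a}) :
  sval x = sval y -> x = y.
Proof.
case: x y => [x hx] [y hy] /= e; subst y.
by rewrite (Prop_irrelevance hx hy).
Qed.

Section Wide.
Context (C : category) (W : arr_class C).

Definition wide_arr (X Y : C) : Type := {f : arr X Y | W X Y f}.

Definition wide_id (X : C) : wide_arr X X := exist _ (idc X) (in_class_id W X).

Definition wide_comp (X Y Z : C) (g : wide_arr Y Z) (f : wide_arr X Y) :
  wide_arr X Z :=
  exist _ (comp (sval g) (sval f)) (in_class_comp (svalP g) (svalP f)).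

Definition wide : category.
Proof.
refine (@Category C wide_arr wide_id wide_comp _ _ _).
- by move=> X Y f; apply: sig_val_inj; apply: comp_idl.
- by move=> X Y f; apply: sig_val_inj; apply: comp_idr.
- by move=> X Y Z T f g h; apply: sig_val_inj; apply: comp_assoc.
Defined.

End Wide.

Definition birestriction (C D : category) (F : functor C D)
  (W : arr_class C) (V : arr_class D)
  (FWV : forall (X Y : C) (f : arr X Y), W X Y f -> V (F X) (F Y) (farr F f)) :
  functor (wide W) (wide V).
Proof.
refine (@Functor (wide W) (wide V) (fun X : C => F X)
  (fun X Y (f : wide_arr W X Y) =>
     exist _ (farr F (sval f)) (FWV X Y (sval f) (svalP f))) _ _).
- by move=> X; apply: sig_val_inj; apply: farr_id.
- by move=> X Y Z g f; apply: sig_val_inj; apply: farr_comp.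
Defined.

Definition wide_incl (C : category) (W W' : arr_class C)
  (WW' : forall (X Y : C) (f : arr X Y), W X Y f -> W' X Y f) :
  functor (wide W) (wide W').
Proof.
refine (@Functor (wide W) (wide W') (fun X : C => X)
  (fun X Y (f : wide_arr W X Y) =>
     exist _ (sval f) (WW' X Y (sval f) (svalP f))) _ _).
- by move=> X; apply: sig_val_inj.
- by move=> X Y Z g f; apply: sig_val_inj.
Defined.

Definition full_sub (C : category) (X : Type) (o : X -> C) : category :=
  @Category X (fun x y => arr (o x) (o y)) (fun x => idc (o x))
    (fun x y z g f => comp g f)
    (fun x y f => comp_idl f) (fun x y f => comp_idr f)
    (fun x y z t f g h => comp_assoc f g h).

Definition signature := nat -> Type.

Definition plural (Sg : signature) : Prop :=
  (Sg 0 -> False) /\ exists2 n, 2 <= n & inhabited (Sg n).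

Definition surjective (A B : Type) (f : A -> B) : Prop :=
  forall y, exists x, f x = y.

Lemma surjective_id (A : Type) : surjective (fun x : A => x).
Proof. by move=> x; exists x. Qed.

Lemma surjective_comp (A B C : Type) (g : B -> C) (f : A -> B) :
  surjective g -> surjective f -> surjective (fun x => g (f x)).
Proof. by move=> hg hf z; have [y <-] := hg z; have [x <-] := hf y; exists x. Qed.

Lemma projT2_inj (I : Type) (T : I -> Type) (i : I) (x y : T i) :
  existT T i x = existT T i y -> x = y.
Proof.
move=> e; have := projT2_eq e => /=.
by rewrite (Prop_irrelevance (projT1_eq e) erefl).
Qed.

Section Algebras.
Context (Sg : signature).

Record algebra := Algebra {
  carrier :> Type;
  op : forall n, Sg n -> ('I_n -> carrier) -> carrier;
  algebra_inh : inhabited carrier }.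

Record hom (A B : algebra) := Hom {
  hom_fun :> A -> B;
  homP : forall n (s : Sg n) (x : 'I_n -> A),
    hom_fun (op s x) = op s (fun k => hom_fun (x k)) }.

Lemma hom_eq (A B : algebra) (f g : hom A B) : (forall x, f x = g x) -> f = g.
Proof.
case: f g => [f hf] [g hg] /= e; have {}e : f = g by exact: funext.
by subst g; rewrite (Prop_irrelevance hf hg).
Qed.

Definition hom_id (A : algebra) : hom A A :=
  @Hom A A (fun x => x) (fun _ _ _ => erefl).

Definition hom_comp (A B C : algebra) (g : hom B C) (f : hom A B) : hom A C.
Proof.
refine (@Hom A C (fun x => g (f x)) _).
by move=> n s x; rewrite !homP.
Defined.

Definition Alg : category.
Proof.
refine (@Category algebra hom hom_id hom_comp _ _ _).
- by move=> A B f; apply: hom_eq.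
- by move=> A B f; apply: hom_eq.
- by move=> A B C D f g h; apply: hom_eq.
Defined.

Definition alg_surj : arr_class Alg :=
  @ArrClass Alg (fun A B (f : hom A B) => surjective f)
    (fun A => @surjective_id A)
    (fun A B C g f => @surjective_comp A B C g f).

Definition Alg_s : category := wide alg_surj.

Record subalgebra (M : algebra) := Subalgebra {
  sub_mem :> M -> Prop;
  sub_closed : forall n (s : Sg n) (x : 'I_n -> M),
    (forall k, sub_mem (x k)) -> sub_mem (op s x);
  sub_inh : exists x, sub_mem x }.

Definition sub_alg (M : algebra) (A : subalgebra M) : algebra.
Proof.
refine (@Algebra {x : M | A x}
  (fun n s x => exist _ (op s (fun k => sval (x k)))
                        (sub_closed s (fun k => svalP (x k)))) _).
by case: (sub_inh A) => x hx; constructor; exists x.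
Defined.

Definition full_subalgebra (M : algebra) : subalgebra M.
Proof.
refine (@Subalgebra M (fun _ => True) (fun _ _ _ _ => I) _).
by case: (algebra_inh M) => x; exists x.
Defined.

End Algebras.

Arguments op [Sg a n] s x.
Coercion sub_alg : subalgebra >-> algebra.

(* Indexed by one less than the number of arguments. *)
Fixpoint iterate (T : Type) (D : T -> T -> T) (n : nat) : ('I_n.+1 -> T) -> T :=
  match n return ('I_n.+1 -> T) -> T with
  | 0 => fun x => x ord0
  | m.+1 => fun x =>
      D (iterate D (fun k : 'I_m.+1 => x (widen_ord (leqnSn m.+1) k)))
        (x ord_max)
  end.

Lemma iterate_morph (T U : Type) (D : T -> T -> T) (E : U -> U -> U)
  (f : T -> U) : (forall x y, f (D x y) = E (f x) (f y)) ->
  forall n (x : 'I_n.+1 -> T), f (iterate D x) = iterate E (fun k => f (x k)).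
Proof. by move=> fD; elim=> [|n IH] x //=; rewrite fD IH. Qed.

(* The order display is a mere notational tag. *)
Record semilattice := Semilattice {
  sl_disp : Order.disp_t;
  sl_sort :> joinSemilatticeType sl_disp;
  sl_inh : inhabited sl_sort }.

Record sl_hom (I P : semilattice) := SlHom {
  sl_fun :> I -> P;
  sl_homP : forall x y, sl_fun (x `|` y)%O = (sl_fun x `|` sl_fun y)%O }.

Lemma sl_hom_eq (I P : semilattice) (f g : sl_hom I P) :
  (forall x, f x = g x) -> f = g.
Proof.
case: f g => [f hf] [g hg] /= e; have {}e : f = g by exact: funext.
by subst g; rewrite (Prop_irrelevance hf hg).
Qed.

Definition sl_id (I : semilattice) : sl_hom I I :=
  @SlHom I I (fun x => x) (fun _ _ => erefl).

Definition sl_comp (I J K : semilattice) (g : sl_hom J K) (f : sl_hom I J) :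
  sl_hom I K.
Proof.
by refine (@SlHom I K (fun x => g (f x)) _) => x y; rewrite !sl_homP.
Defined.

Lemma sl_mono (I P : semilattice) (f : sl_hom I P) (i j : I) :
  (i <= j)%O -> (f i <= f j)%O.
Proof. by rewrite !leEjoin => /eqP {2}<-; rewrite sl_homP. Qed.

Definition Sl : category.
Proof.
refine (@Category semilattice sl_hom sl_id sl_comp _ _ _).
- by move=> I P f; apply: sl_hom_eq.
- by move=> I P f; apply: sl_hom_eq.
- by move=> I J K L f g h; apply: sl_hom_eq.
Defined.

Definition sl_surj : arr_class Sl :=
  @ArrClass Sl (fun I P (f : sl_hom I P) => surjective f)
    (fun I => @surjective_id I)
    (fun I J K g f => @surjective_comp I J K g f).

Definition Sl_s : category := wide sl_surj.

Lemma iterate_join_le (I : semilattice) n (ii : 'I_n.+1 -> I) (j : I) :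
  (iterate Order.join ii <= j)%O <-> (forall k, (ii k <= j)%O).
Proof.
elim: n ii => [|n IH] ii /=.
  by split=> [h k|]; [rewrite (ord1 k)|apply].
rewrite leUx; split=> [/andP[/IH h1 h2] k|h].
  have [e|ne] := eqVneq k ord_max; first by rewrite e.
  have lt : k < n.+1.
    by rewrite ltn_neqAle -ltnS (ltn_ord k) andbT; apply: contraNneq ne => e; apply/eqP/val_inj.
  suff -> : k = widen_ord (leqnSn n.+1) (Ordinal lt) by apply: h1.
  exact: val_inj.
by apply/andP; split; [apply/IH => k|].
Qed.

(* The join of a nonempty finite family.  Nonemptiness comes from the arity
   of s, as a plural signature has no constants. *)
Section FamilyJoin.
Context (Sg : signature) (hS : plural Sg) (I : semilattice).

Definition sl_op (n : nat) : Sg n -> ('I_n -> I) -> I :=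
  match n return Sg n -> ('I_n -> I) -> I with
  | 0 => fun s _ => False_rect I (hS.1 s)
  | m.+1 => fun _ ii => iterate Order.join ii
  end.

Lemma sl_op_le n (s : Sg n) (ii : 'I_n -> I) (j : I) :
  (sl_op s ii <= j)%O <-> (forall k, (ii k <= j)%O).
Proof.
case: n s ii => [|n] s ii /=; first by case: (hS.1 s).
exact: iterate_join_le.
Qed.

Lemma sl_op_ub n (s : Sg n) (ii : 'I_n -> I) k : (ii k <= sl_op s ii)%O.
Proof. by move: k; apply/sl_op_le. Qed.

End FamilyJoin.

Lemma sl_op_morph (Sg : signature) (hS : plural Sg) (I P : semilattice)
  (f : sl_hom I P) n (s : Sg n) (ii : 'I_n -> I) :
  f (sl_op hS s ii) = sl_op hS s (fun k => f (ii k)).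
Proof.
case: n s ii => [|n] s ii; first by case: (hS.1 s).
by apply: iterate_morph; apply: sl_homP.
Qed.

Section Isys.
Context (Sg : signature).
Local Notation algebra := (algebra Sg).

Record isys (I : semilattice) := ISys {
  is_alg :> I -> algebra;
  is_map : forall i j : I, (i <= j)%O -> hom (is_alg i) (is_alg j);
  is_map_id : forall (i : I) (h : (i <= i)%O) (x : is_alg i), is_map h x = x;
  is_map_comp : forall (i j k : I) (hij : (i <= j)%O) (hjk : (j <= k)%O)
    (hik : (i <= k)%O) (x : is_alg i),
    is_map hjk (is_map hij x) = is_map hik x }.

Record isys_hom (I : semilattice) (A B : isys I) := IsysHom {
  ih_fun :> forall i : I, hom (A i) (B i);
  ih_natural : forall (i j : I) (h : (i <= j)%O) (x : A i),
    ih_fun j (is_map A h x) = is_map B h (ih_fun i x) }.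

Definition isys_reindex (I P : semilattice) (xi : sl_hom I P) (B : isys P) :
  isys I.
Proof.
refine (@ISys I (fun i => B (xi i)) (fun i j h => is_map B (sl_mono xi h)) _ _).
- by move=> i h x; apply: is_map_id.
- by move=> i j k hij hjk hik x; apply: is_map_comp.
Defined.

Record isys_obj := IsysObj {
  io_base : semilattice;
  io_sys :> isys io_base }.

Record isys_arr (X Y : isys_obj) := IsysArr {
  ia_base : sl_hom (io_base X) (io_base Y);
  ia_fib : isys_hom X (isys_reindex ia_base Y) }.

Lemma isys_arr_eq (X Y : isys_obj) (f g : isys_arr X Y) :
  (forall (i : io_base X) (x : io_sys X i),
    existT (fun p => io_sys Y p : Type) (ia_base f i) (ia_fib f i x) =
    existT (fun p => io_sys Y p : Type) (ia_base g i) (ia_fib g i x)) -> f = g.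
Proof.
case: f g => [xi u] [zeta v] /= e.
have eb : xi = zeta.
  by apply: sl_hom_eq => i; case: (algebra_inh (X i)) => x; exact: projT1_eq (e i x).
subst zeta.
suff -> : u = v by [].
have {}e : forall i x, u i x = v i x by move=> i x; apply: projT2_inj (e i x).
case: u v e => [u hu] [v hv] /= e.
have euv : u = v by apply: functional_extensionality_dep => i; apply: hom_eq => x; exact: e.
by subst v; rewrite (Prop_irrelevance hu hv).
Qed.

Definition isys_arr_id (X : isys_obj) : isys_arr X X.
Proof.
refine (@IsysArr X X (sl_id _)
  (@IsysHom _ _ (isys_reindex (sl_id _) X) (fun i => hom_id (X i)) _)).
by move=> i j h x /=; congr (is_map X _ x); apply: Prop_irrelevance.
Defined.

Definition isys_arr_comp (X Y Z : isys_obj) (g : isys_arr Y Z)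
  (f : isys_arr X Y) : isys_arr X Z.
Proof.
refine (@IsysArr X Z (sl_comp (ia_base g) (ia_base f))
  (@IsysHom _ _ (isys_reindex (sl_comp (ia_base g) (ia_base f)) Z)
    (fun i => hom_comp (ia_fib g (ia_base f i)) (ia_fib f i)) _)).
move=> i j h x /=; rewrite ih_natural /= ih_natural /=.
by congr (is_map Z _ _); apply: Prop_irrelevance.
Defined.

(* IntC_F denotes the total category (Grothendieck construction) of F over C. *)
Definition IntSl_Isys : category.
Proof.
refine (@Category isys_obj isys_arr isys_arr_id isys_arr_comp _ _ _).
- by move=> X Y f; apply: isys_arr_eq.
- by move=> X Y f; apply: isys_arr_eq.
- by move=> X Y Z T f g h; apply: isys_arr_eq.
Defined.

Definition isys_base_surj : arr_class IntSl_Isys :=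
  @ArrClass IntSl_Isys (fun X Y (f : isys_arr X Y) => surjective (ia_base f))
    (fun X => @surjective_id (io_base X))
    (fun X Y Z g f => @surjective_comp _ _ _ (ia_base g) (ia_base f)).

Definition IntSls_Isys : category := wide isys_base_surj.

End Isys.

Section PlAlg.
Context (Sg : signature).

Record plonka_alg := PlonkaAlg {
  pl_alg :> algebra Sg;
  pl_D : pl_alg -> pl_alg -> pl_alg;
  pl_idem : forall x, pl_D x x = x;
  pl_assoc : forall x y z, pl_D x (pl_D y z) = pl_D (pl_D x y) z;
  pl_comm : forall x y z, pl_D x (pl_D y z) = pl_D x (pl_D z y);
  pl_op_l : forall n (s : Sg n.+1) (x : 'I_n.+1 -> pl_alg) (y : pl_alg),
    pl_D (op s x) y = op s (fun k => pl_D (x k) y);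
  pl_op_r : forall n (s : Sg n.+1) (x : 'I_n.+1 -> pl_alg) (y : pl_alg),
    pl_D y (op s x) = pl_D y (iterate pl_D x) }.

Record pl_hom (A B : plonka_alg) := PlHom {
  pl_hom_hom :> hom A B;
  pl_homP : forall x y, pl_D (pl_hom_hom x) (pl_hom_hom y) = pl_hom_hom (pl_D x y) }.

Lemma pl_hom_eq (A B : plonka_alg) (f g : pl_hom A B) :
  (forall x, f x = g x) -> f = g.
Proof.
case: f g => [f hf] [g hg] /= e; have {}e : f = g by exact: hom_eq.
by subst g; rewrite (Prop_irrelevance hf hg).
Qed.

Definition pl_hom_id (A : plonka_alg) : pl_hom A A :=
  @PlHom A A (hom_id A) (fun _ _ => erefl).

Definition pl_hom_comp (A B C : plonka_alg) (g : pl_hom B C) (f : pl_hom A B) :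
  pl_hom A C.
Proof.
by refine (@PlHom A C (hom_comp g f) _) => x y /=; rewrite !pl_homP.
Defined.

Definition PlAlg : category.
Proof.
refine (@Category plonka_alg pl_hom pl_hom_id pl_hom_comp _ _ _).
- by move=> A B f; apply: pl_hom_eq.
- by move=> A B f; apply: pl_hom_eq.
- by move=> A B C D f g h; apply: pl_hom_eq.
Defined.

Definition pl_surj : arr_class PlAlg :=
  @ArrClass PlAlg (fun A B (f : pl_hom A B) => surjective f)
    (fun A => @surjective_id A)
    (fun A B C g f => @surjective_comp A B C g f).

Definition PlAlg_s : category := wide pl_surj.

Definition Phi (A : plonka_alg) (x y : A) : Prop :=
  pl_D x y = x /\ pl_D y x = y.

Lemma Phi_refl (A : plonka_alg) (x : A) : Phi x x.
Proof. by split; apply: pl_idem. Qed.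

Lemma Phi_sym (A : plonka_alg) (x y : A) : Phi x y -> Phi y x.
Proof. by case. Qed.

Lemma Phi_trans (A : plonka_alg) (y x z : A) : Phi x y -> Phi y z -> Phi x z.
Proof.
move=> [xy yx] [yz zy]; split.
  by rewrite -{1}xy -pl_assoc yz xy.
by rewrite -{1}zy -pl_assoc yx zy.
Qed.

Lemma pl_D_iterate (A : plonka_alg) n (x y : 'I_n.+1 -> A) (w : A) :
  pl_D w (iterate (@pl_D A) (fun k => pl_D (x k) (y k))) =
  pl_D (pl_D w (iterate (@pl_D A) x)) (iterate (@pl_D A) y).
Proof.
elim: n x y w => [|n IH] x y w; first by rewrite /= pl_assoc.
move=> /=; rewrite pl_assoc IH !pl_assoc; congr (pl_D _ _).
set a := iterate _ _; set b := iterate _ _.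
by rewrite -!pl_assoc; congr (pl_D w _); rewrite pl_comm.
Qed.

Lemma Phi_op (A : plonka_alg) n (s : Sg n) (x y : 'I_n -> A) :
  (forall k, Phi (x k) (y k)) -> Phi (op s x) (op s y).
Proof.
case: n s x y => [|n] s x y h.
  have -> : x = y by apply: funext => -[].
  exact: Phi_refl.
suff H : forall u v : 'I_n.+1 -> A, (forall k, Phi (u k) (v k)) ->
    pl_D (op s u) (op s v) = op s u.
  by split; apply: H => // k; apply: Phi_sym.
move=> u v uv; have eu : pl_D (op s u) (iterate (@pl_D A) u) = op s u.
  by rewrite -(pl_op_r s) pl_idem.
rewrite pl_op_r -{1}eu -pl_D_iterate.
by rewrite (_ : (fun k => _) = u) ?eu //; apply: funext => k; case: (uv k).
Qed.

(* {classic A} is A itself, equipped with a classical choice operator. *)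
Definition Phi_rel (A : plonka_alg) : rel {classic A} :=
  fun x y => `[< @Phi A x y >].

Lemma Phi_rel_equiv (A : plonka_alg) : equiv_class_of (@Phi_rel A).
Proof.
split.
- by move=> x; apply/asboolP; apply: Phi_refl.
- by move=> x y; apply/asboolP/asboolP; apply: Phi_sym.
- by move=> y x z /asboolP h1 /asboolP h2; apply/asboolP; apply: Phi_trans h1 h2.
Qed.

Canonical Phi_equiv (A : plonka_alg) := EquivRelPack (Phi_rel_equiv A).

Definition quot_carrier (A : plonka_alg) : Type := {eq_quot (Phi_equiv A)}%qT.

Definition qclass (A : plonka_alg) (x : A) : quot_carrier A :=
  (\pi_({eq_quot (Phi_equiv A)}) (x : {classic A}))%qT.

Definition qrepr (A : plonka_alg) (c : quot_carrier A) : A :=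
  (repr (c : {eq_quot (Phi_equiv A)}))%qT.

Lemma qreprK (A : plonka_alg) (c : quot_carrier A) : qclass (qrepr c) = c.
Proof. exact: (reprK (c : {eq_quot (Phi_equiv A)}%qT)). Qed.

Lemma qclassP (A : plonka_alg) (x y : A) : qclass x = qclass y <-> Phi x y.
Proof.
split=> [/eqP|h]; last apply/eqP.
  by rewrite eqmodE => /asboolP.
by rewrite eqmodE; apply/asboolP.
Qed.

Lemma qreprP (A : plonka_alg) (x : A) : Phi (qrepr (qclass x)) x.
Proof. by apply/qclassP; apply: qreprK. Qed.

Definition quot_alg (A : plonka_alg) : algebra Sg.
Proof.
refine (@Algebra Sg (quot_carrier A)
  (fun n s c => qclass (op s (fun k => qrepr (c k)))) _).
by case: (algebra_inh A) => x; constructor; exact: (qclass x).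
Defined.

Lemma quot_opE (A : plonka_alg) n (s : Sg n) (x : 'I_n -> A) :
  @op Sg (quot_alg A) n s (fun k => qclass (x k)) = qclass (op s x).
Proof. by apply/qclassP; apply: Phi_op => k; apply: qreprP. Qed.

Lemma Phi_hom (A B : plonka_alg) (h : pl_hom A B) (x y : A) :
  Phi x y -> Phi (h x) (h y).
Proof. by move=> [xy yx]; split; rewrite pl_homP ?xy ?yx. Qed.

Definition quot_hom_fun (A B : plonka_alg) (h : pl_hom A B)
  (c : quot_alg A) : quot_alg B := qclass (h (qrepr c)).

Lemma quot_hom_funE (A B : plonka_alg) (h : pl_hom A B) (x : A) :
  quot_hom_fun h (qclass x) = qclass (h x).
Proof. by apply/qclassP; apply: Phi_hom; apply: qreprP. Qed.

Definition quot_hom (A B : plonka_alg) (h : pl_hom A B) :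
  hom (quot_alg A) (quot_alg B).
Proof.
refine (@Hom Sg (quot_alg A) (quot_alg B) (quot_hom_fun h) _).
move=> n s c; rewrite [LHS]quot_hom_funE homP -quot_opE.
by congr (op s); apply: funext => k; rewrite -quot_hom_funE qreprK.
Defined.

Definition quot_functor : functor PlAlg (Alg Sg).
Proof.
refine (@Functor PlAlg (Alg Sg) quot_alg quot_hom _ _).
- by move=> A; apply: hom_eq => c /=; apply: qreprK.
- move=> A B C g f; apply: hom_eq => c /=.
  by rewrite -[c]qreprK !quot_hom_funE.
Defined.

Lemma quot_functor_surj (A B : PlAlg) (f : arr A B) :
  pl_surj A B f -> @alg_surj Sg _ _ (farr quot_functor f).
Proof.
move=> hf c /=; have [x e] := hf (qrepr c).
by exists (qclass x); rewrite quot_hom_funE e qreprK.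
Qed.

Definition P : functor PlAlg_s (Alg_s Sg) := birestriction quot_functor_surj.

(* The class of the morphisms h such that [x] |-> [h x] is surjective; it
   contains all surjective morphisms. *)
Definition pl_quot_surj : arr_class PlAlg.
Proof.
refine (@ArrClass PlAlg
  (fun A B f => @alg_surj Sg _ _ (farr quot_functor f)) _ _).
- by move=> A; rewrite farr_id; apply: in_class_id.
- by move=> A B C g f hg hf; rewrite farr_comp; apply: in_class_comp.
Defined.

Definition PlAlg_qs : category := wide pl_quot_surj.

Definition P_qs : functor PlAlg_qs (Alg_s Sg) :=
  @birestriction _ _ quot_functor pl_quot_surj (@alg_surj Sg)
    (fun _ _ _ h => h).

End PlAlg.

Section PlonkaFunctor.
Context (Sg : signature) (hS : plural Sg).

Section Sum.
Context (X : isys_obj Sg).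
Local Notation I := (io_base X).
Local Notation T := (fun i : I => X i : Type).

Definition plonka_carrier : Type := {i : I & X i}.

Definition plonka_op n (s : Sg n) (x : 'I_n -> plonka_carrier) :
  plonka_carrier :=
  existT T (sl_op hS s (fun k => projT1 (x k)))
    (op s (fun k => is_map X (sl_op_ub hS s (fun k => projT1 (x k)) k)
                      (projT2 (x k)))).

Definition plonka_sum : algebra Sg.
Proof.
refine (@Algebra Sg plonka_carrier plonka_op _).
case: (sl_inh I) => i; case: (algebra_inh (X i)) => x.
by constructor; exists i.
Defined.

Definition plonka_D (x y : plonka_carrier) : plonka_carrier :=
  existT T (projT1 x `|` projT1 y)%O
    (is_map X (leUl (projT1 x) (projT1 y)) (projT2 x)).

Lemma tag_map_eq (i j k : I) (hj : (i <= j)%O) (hk : (i <= k)%O) (x : X i) :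
  j = k -> existT T j (is_map X hj x) = existT T k (is_map X hk x).
Proof. by move=> e; subst k; rewrite (Prop_irrelevance hj hk). Qed.

Lemma tag_map_id (i : I) (j : I) (h : (i <= j)%O) (x : X i) :
  j = i -> existT T j (is_map X h x) = existT T i x.
Proof. by move=> e; subst j; rewrite is_map_id. Qed.

Lemma tag_op_eq n (s : Sg n) (ii : 'I_n -> I) (j k : I)
  (hj : forall l, (ii l <= j)%O) (hk : forall l, (ii l <= k)%O)
  (x : forall l, X (ii l)) : j = k ->
  existT T j (op s (fun l => is_map X (hj l) (x l))) =
  existT T k (op s (fun l => is_map X (hk l) (x l))).
Proof.
by move=> e; subst k; congr (existT T j (op s _)); apply: funext => l;
  rewrite (Prop_irrelevance (hj l) (hk l)).
Qed.

Lemma plonka_D_idem x : plonka_D x x = x.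
Proof. by case: x => i x; apply: tag_map_id; rewrite /= joinxx. Qed.

Lemma plonka_D_assoc x y z :
  plonka_D x (plonka_D y z) = plonka_D (plonka_D x y) z.
Proof.
case: x y z => [i x] [j y] [k z]; rewrite /plonka_D /=.
rewrite (is_map_comp _ _ (le_trans (leUl _ _) (leUl (i `|` j)%O k))).
by apply: tag_map_eq; rewrite joinA.
Qed.

Lemma plonka_D_comm x y z :
  plonka_D x (plonka_D y z) = plonka_D x (plonka_D z y).
Proof.
case: x y z => [i x] [j y] [k z]; apply: tag_map_eq.
by rewrite /= (joinC j k).
Qed.

Lemma plonka_D_op_l n (s : Sg n.+1) (x : 'I_n.+1 -> plonka_sum)
  (y : plonka_sum) :
  plonka_D (op s x) y = op s (fun k => plonka_D (x k) y : plonka_sum).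
Proof.
rewrite /plonka_D /=.
pose ii k := projT1 (x k); pose b := projT1 y.
have e : (sl_op hS s ii `|` b)%O = sl_op hS s (fun k => (ii k `|` b)%O).
  apply/eqP; rewrite eq_le; apply/andP; split.
    rewrite leUx; apply/andP; split.
      apply/sl_op_le => k.
      exact: le_trans (leUl _ _) (sl_op_ub hS s (fun k => (ii k `|` b)%O) k).
    exact: le_trans (leUr _ _) (sl_op_ub hS s (fun k => (ii k `|` b)%O) ord0).
  by apply/sl_op_le => k; apply: leU2 => //; apply: sl_op_ub.
rewrite homP /plonka_op /=.
pose h1 k := le_trans (sl_op_ub hS s ii k) (leUl (sl_op hS s ii) b).
pose h2 k : (ii k <= sl_op hS s (fun k => (ii k `|` b)%O))%O :=
  le_trans (leUl _ _) (sl_op_ub hS s (fun k => (ii k `|` b)%O) k).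
transitivity (existT T _ (op s (fun k => is_map X (h1 k) (projT2 (x k))))).
  by congr (existT T _ (op s _)); apply: funext => k; apply: is_map_comp.
rewrite (tag_op_eq s h1 h2 _ e).
by congr (existT T _ (op s _)); apply: funext => k; rewrite (is_map_comp _ _ (h2 k)).
Qed.

Lemma projT1_iterate n (x : 'I_n.+1 -> plonka_carrier) :
  projT1 (iterate plonka_D x) = iterate Order.join (fun k => projT1 (x k)).
Proof. by apply: iterate_morph. Qed.

Lemma plonka_D_op_r n (s : Sg n.+1) (x : 'I_n.+1 -> plonka_sum)
  (y : plonka_sum) :
  plonka_D y (op s x) = plonka_D y (iterate plonka_D x).
Proof. by apply: tag_map_eq; rewrite projT1_iterate. Qed.

Definition plonka_obj : plonka_alg Sg :=
  @PlonkaAlg Sg plonka_sum plonka_D plonka_D_idem plonka_D_assoc plonka_D_comm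
    plonka_D_op_l plonka_D_op_r.

End Sum.

Section SumArr.
Context (X Y : isys_obj Sg) (f : isys_arr X Y).
Local Notation T := (fun p : io_base Y => Y p : Type).

Definition plonka_fun (x : plonka_obj X) : plonka_obj Y :=
  existT T (ia_base f (projT1 x)) (ia_fib f (projT1 x) (projT2 x)).

Lemma plonka_funP n (s : Sg n) (x : 'I_n -> plonka_obj X) :
  plonka_fun (op s x) = op s (fun k => plonka_fun (x k)).
Proof.
rewrite /plonka_fun /= homP /plonka_op /=.
pose ii k := projT1 (x k).
have h1 k : (ia_base f (ii k) <= ia_base f (sl_op hS s ii))%O.
  by apply: sl_mono; apply: sl_op_ub.
rewrite -(tag_op_eq s h1 (sl_op_ub hS s (fun k => ia_base f (ii k))) _
            (sl_op_morph hS (ia_base f) s ii)).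
congr (existT T _ (op s _)); apply: funext => k; rewrite ih_natural /=.
by congr (is_map Y _ _); apply: Prop_irrelevance.
Qed.

Lemma plonka_fun_D (x y : plonka_obj X) :
  pl_D (plonka_fun x) (plonka_fun y) = plonka_fun (pl_D x y).
Proof.
rewrite /plonka_fun /= /plonka_D /= ih_natural /=.
by apply: tag_map_eq; rewrite sl_homP.
Qed.

Definition plonka_arr : pl_hom (plonka_obj X) (plonka_obj Y) :=
  @PlHom Sg (plonka_obj X) (plonka_obj Y) (Hom plonka_funP) plonka_fun_D.

End SumArr.

Definition plonka_functor : functor (IntSl_Isys Sg) (PlAlg Sg).
Proof.
refine (@Functor (IntSl_Isys Sg) (PlAlg Sg) plonka_obj plonka_arr _ _).
- by move=> X; apply: pl_hom_eq => -[i x].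
- by move=> X Y Z g f; apply: pl_hom_eq => -[i x].
Defined.

Lemma plonka_functor_quot_surj (X Y : IntSl_Isys Sg) (f : arr X Y) :
  isys_base_surj Sg X Y f -> pl_quot_surj Sg _ _ (farr plonka_functor f).
Proof.
move=> hf c; rewrite -[c]qreprK; case: (qrepr c) => p y {c}.
have [i e] := hf p; case: (algebra_inh (io_sys X i)) => x.
exists (qclass (existT _ i x : plonka_obj X)).
rewrite /= quot_hom_funE; apply/qclassP.
have tE (q r : io_base Y) (a : Y q) (b : Y r) : q = r ->
    Phi (existT _ q a : plonka_obj Y) (existT _ r b : plonka_obj Y).
  by move=> eqr; subst r; split; apply: tag_map_id; rewrite /= joinxx.
exact: tE.
Qed.

(* If xi is surjective but some u_i is not, Pl(xi, u) need not be surjective.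
   Hence the Plonka functor restricts in two ways: on all of IntSls_Isys, with
   values in PlAlg_qs, and on those morphisms of IntSls_Isys that it sends
   into PlAlg_s, with values in PlAlg_s. *)
Definition Pl_qs : functor (IntSls_Isys Sg) (PlAlg_qs Sg) :=
  birestriction plonka_functor_quot_surj.

Definition isys_Pl_surj : arr_class (IntSl_Isys Sg).
Proof.
refine (@ArrClass (IntSl_Isys Sg)
  (fun X Y f => isys_base_surj Sg X Y f /\
                pl_surj Sg _ _ (farr plonka_functor f)) _ _).
- by move=> X; rewrite farr_id; split; apply: in_class_id.
- move=> X Y Z g f [g1 g2] [f1 f2]; rewrite farr_comp.
  by split; apply: in_class_comp.
Defined.

Definition IntSls_Isys_Pl : category := wide isys_Pl_surj.

Definition Pl_s : functor IntSls_Isys_Pl (PlAlg_s Sg) :=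
  @birestriction _ _ plonka_functor isys_Pl_surj (pl_surj Sg)
    (fun _ _ _ h => h.2).

Definition IntSls_Isys_Pl_incl : functor IntSls_Isys_Pl (IntSls_Isys Sg) :=
  @wide_incl _ isys_Pl_surj (isys_base_surj Sg) (fun _ _ _ h => h.1).

End PlonkaFunctor.

Section Npi.
Context (Sg : signature).
Local Notation algebra := (algebra Sg).

(* The arity is positive, as it has an element k. *)
Definition alg_prec (I : algebra) (b a : I) : Prop :=
  exists n (s : Sg n) (x : 'I_n -> I) (k : 'I_n), a = op s x /\ b = x k.

Definition alg_le (I : algebra) : I -> I -> Prop :=
  clos_refl_trans I (@alg_prec I).

Lemma alg_le_trans (I : algebra) (j i k : I) :
  alg_le i j -> alg_le j k -> alg_le i k.
Proof. exact: rt_trans. Qed.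

Lemma alg_le_op (I : algebra) n (s : Sg n) (x : 'I_n -> I) (i : I) :
  i = op s x -> forall k, alg_le (x k) i.
Proof. by move=> e k; apply: rt_step; exists n, s, x, k. Qed.

Lemma alg_le_hom (I P : algebra) (t : hom I P) (i j : I) :
  alg_le i j -> alg_le (t i) (t j).
Proof.
elim=> [b a [n [s [x [k [-> ->]]]]]|a|a b c _ h1 _ h2].
- by apply: (@alg_le_op _ n s (fun l => t (x l))); rewrite homP.
- exact: rt_refl.
- exact: alg_le_trans h1 h2.
Qed.

Record npi_alg := NpiAlg {
  npi_sort :> algebra;
  npi_idem : forall n (s : Sg n) (i : npi_sort), op s (fun _ => i) = i;
  npi_isotone : forall n (s : Sg n) (x y : 'I_n -> npi_sort),
    (forall k, alg_le (x k) (y k)) -> alg_le (op s x) (op s y) }.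

Definition NPIAlg_s : category := @full_sub (Alg_s Sg) npi_alg npi_sort.

(* The equation e : i = op s x is an argument, rather than op s x being
   substituted for i, so that systems can be reindexed without transport. *)
Record lsys (I : npi_alg) := LSys {
  ls_M : I -> algebra;
  ls_A : forall i : I, subalgebra (ls_M i);
  ls_map : forall i j : I, alg_le i j -> hom (ls_A i) (ls_M j);
  ls_closed : forall n (s : Sg n) (ii : 'I_n -> I) (i : I) (e : i = op s ii)
    (a : forall k, ls_A (ii k)),
    ls_A i (op s (fun k => ls_map (alg_le_op e k) (a k)));
  ls_map_op : forall n (s : Sg n) (ii : 'I_n -> I) (i : I) (e : i = op s ii)
    (a : forall k, ls_A (ii k)) (j : I) (hij : alg_le i j),
    ls_map hij (exist _ _ (ls_closed e a)) =
    op s (fun k => ls_map (alg_le_trans (alg_le_op e k) hij) (a k));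
  ls_map_id : forall (i : I) (h : alg_le i i) (a : ls_A i),
    ls_map h a = sval a }.

Record lsys_hom (I : npi_alg) (A B : lsys I) := LsysHom {
  lh_fun :> forall i : I, hom (ls_M A i) (ls_M B i);
  lh_mem : forall (i : I) (a : ls_M A i), ls_A A i a -> ls_A B i (lh_fun i a);
  lh_natural : forall (i j : I) (h : alg_le i j) (a : ls_A A i),
    lh_fun j (ls_map A h a) =
    ls_map B h (exist _ (lh_fun i (sval a)) (lh_mem (svalP a))) }.

Lemma ls_map_irr (I : npi_alg) (A : lsys I) (i j : I) (h h' : alg_le i j)
  (a a' : ls_A A i) : sval a = sval a' -> ls_map A h a = ls_map A h' a'.
Proof. by move=> /sig_val_inj ->; rewrite (Prop_irrelevance h h'). Qed.

Section Reindex.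
Context (I P : npi_alg) (t : hom I P) (B : lsys P).

Lemma reindex_eq n (s : Sg n) (ii : 'I_n -> I) (i : I) :
  i = op s ii -> t i = op s (fun k => t (ii k)).
Proof. by move=> ->; rewrite homP. Qed.

Lemma reindex_opE n (s : Sg n) (ii : 'I_n -> I) (i : I) (e : i = op s ii)
  (a : forall k, ls_A B (t (ii k))) :
  op s (fun k => ls_map B (alg_le_hom t (alg_le_op e k)) (a k)) =
  op s (fun k => ls_map B (alg_le_op (reindex_eq e) k) (a k)).
Proof. by congr (op s _); apply: funext => k; apply: ls_map_irr. Qed.

Lemma reindex_closed n (s : Sg n) (ii : 'I_n -> I) (i : I) (e : i = op s ii)
  (a : forall k, ls_A B (t (ii k))) :
  ls_A B (t i) (op s (fun k => ls_map B (alg_le_hom t (alg_le_op e k)) (a k))).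
Proof. by rewrite reindex_opE; apply: ls_closed. Qed.

Definition lsys_reindex : lsys I.
Proof.
refine (@LSys I (fun i => ls_M B (t i)) (fun i => ls_A B (t i))
  (fun i j h => ls_map B (alg_le_hom t h)) reindex_closed _ _).
- move=> n s ii i e a j hij.
  rewrite (@ls_map_irr _ _ _ _ _ (alg_le_hom t hij) _
             (exist _ _ (ls_closed (reindex_eq e) a))) /=; last exact: reindex_opE.
  by rewrite ls_map_op; congr (op s _); apply: funext => k; apply: ls_map_irr.
- by move=> i h a; apply: ls_map_id.
Defined.

End Reindex.

Record lsys_obj := LsysObj {
  lo_base : npi_alg;
  lo_sys :> lsys lo_base }.

Record lsys_arr (X Y : lsys_obj) := LsysArr {
  la_base : @arr NPIAlg_s (lo_base X) (lo_base Y);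
  la_fib : lsys_hom X (lsys_reindex (sval la_base) Y) }.

Lemma lsys_arr_eq (X Y : lsys_obj) (f g : lsys_arr X Y) :
  (forall (i : lo_base X) (x : ls_M X i),
    existT (fun p => ls_M Y p : Type) (sval (la_base f) i) (la_fib f i x) =
    existT (fun p => ls_M Y p : Type) (sval (la_base g) i) (la_fib g i x)) ->
  f = g.
Proof.
case: f g => [t u] [t' v] /= e.
have eb : t = t'.
  apply: sig_val_inj; apply: hom_eq => i.
  by case: (algebra_inh (ls_M X i)) => x; exact: projT1_eq (e i x).
subst t'.
suff -> : u = v by [].
have {}e : forall i x, u i x = v i x by move=> i x; apply: projT2_inj (e i x).
case: u v e => [u mu hu] [v mv hv] /= e.
have euv : u = v by apply: functional_extensionality_dep => i; apply: hom_eq => x; exact: e.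
subst v; have emm : mu = mv by apply: Prop_irrelevance.
by subst mv; rewrite (Prop_irrelevance hu hv).
Qed.

Definition lsys_arr_id (X : lsys_obj) : lsys_arr X X.
Proof.
refine (@LsysArr X X (@idc NPIAlg_s (lo_base X))
  (@LsysHom _ X (lsys_reindex (sval (@idc NPIAlg_s (lo_base X))) X)
    (fun i => hom_id (ls_M X i)) (fun _ _ h => h) _)).
by move=> i j h a /=; apply: ls_map_irr.
Defined.

Definition lsys_arr_comp (X Y Z : lsys_obj) (g : lsys_arr Y Z)
  (f : lsys_arr X Y) : lsys_arr X Z.
Proof.
refine (@LsysArr X Z (comp (la_base g) (la_base f))
  (@LsysHom _ X (lsys_reindex (sval (comp (la_base g) (la_base f))) Z)
    (fun i => hom_comp (la_fib g (sval (la_base f) i)) (la_fib f i))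
    (fun i a h => lh_mem (la_fib g) (lh_mem (la_fib f) h)) _)).
move=> i j h a /=; rewrite lh_natural /= lh_natural /=.
exact: ls_map_irr.
Defined.

Definition IntNPI_Lsys : category.
Proof.
refine (@Category lsys_obj lsys_arr lsys_arr_id lsys_arr_comp _ _ _).
- by move=> X Y f; apply: lsys_arr_eq.
- by move=> X Y f; apply: lsys_arr_eq.
- by move=> X Y Z T f g h; apply: lsys_arr_eq.
Defined.

Record over_obj := OverObj {
  oo_base : npi_alg;
  oo_alg : algebra;
  oo_map : hom oo_alg oo_base;
  oo_surj : surjective oo_map }.

Record over_arr (X Y : over_obj) := OverArr {
  oa_base : @arr NPIAlg_s (oo_base X) (oo_base Y);
  oa_hom : hom (oo_alg X) (oo_alg Y);
  oa_comm : forall x, sval oa_base (oo_map X x) = oo_map Y (oa_hom x) }.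

Lemma over_arr_eq (X Y : over_obj) (f g : over_arr X Y) :
  oa_base f = oa_base g -> oa_hom f = oa_hom g -> f = g.
Proof.
case: f g => [t h c] [t' h' c'] /= e1 e2; subst t' h'.
by rewrite (Prop_irrelevance c c').
Qed.

Definition over_arr_id (X : over_obj) : over_arr X X :=
  @OverArr X X (@idc NPIAlg_s (oo_base X)) (hom_id _) (fun _ => erefl).

Definition over_arr_comp (X Y Z : over_obj) (g : over_arr Y Z)
  (f : over_arr X Y) : over_arr X Z.
Proof.
refine (@OverArr X Z (comp (oa_base g) (oa_base f))
          (hom_comp (oa_hom g) (oa_hom f)) _).
by move=> x /=; rewrite !oa_comm.
Defined.

Definition IntNPI_Over : category.
Proof.
refine (@Category over_obj over_arr over_arr_id over_arr_comp _ _ _).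
- by move=> X Y f; apply: over_arr_eq; [apply: comp_idl|apply: hom_eq].
- by move=> X Y f; apply: over_arr_eq; [apply: comp_idr|apply: hom_eq].
- by move=> X Y Z T f g h; apply: over_arr_eq;
    [apply: comp_assoc|apply: hom_eq].
Defined.

Definition Q : functor IntNPI_Over (Alg_s Sg) :=
  @Functor IntNPI_Over (Alg_s Sg) (fun X : over_obj => npi_sort (oo_base X))
    (fun X Y f => oa_base f) (fun _ => erefl) (fun _ _ _ _ _ => erefl).

Section LallementSum.
Context (X : lsys_obj).
Local Notation I := (lo_base X).
Local Notation T := (fun i : I => ls_A X i : Type).

Definition lall_carrier : Type := {i : I & ls_A X i}.

Definition lall_op n (s : Sg n) (x : 'I_n -> lall_carrier) : lall_carrier :=
  existT T (op s (fun k => projT1 (x k)))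
    (exist _ (op s (fun k => ls_map X (alg_le_op erefl k) (projT2 (x k))))
      (@ls_closed _ X n s (fun k => projT1 (x k)) _ erefl
         (fun k => projT2 (x k)))).

Definition lallement_sum : algebra.
Proof.
refine (@Algebra Sg lall_carrier lall_op _).
case: (algebra_inh I) => i; case: (sub_inh (ls_A X i)) => x hx.
by constructor; exists i, x.
Defined.

Definition lall_proj : hom lallement_sum I :=
  @Hom Sg lallement_sum I (fun x => projT1 x) (fun _ _ _ => erefl).

Lemma lall_proj_surj : surjective lall_proj.
Proof.
move=> i; case: (sub_inh (ls_A X i)) => x hx.
by exists (existT T i (exist _ x hx)).
Qed.

Definition lallement_obj : over_obj := OverObj lall_proj_surj.

Lemma lall_opE n (s : Sg n) (x : 'I_n -> lall_carrier) (i : I)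
  (h : forall k, alg_le (projT1 (x k)) i)
  (m : ls_A X i (op s (fun k => ls_map X (h k) (projT2 (x k))))) :
  i = op s (fun k => projT1 (x k)) ->
  existT T i (exist _ _ m) = lall_op s x.
Proof.
move=> e; subst i; congr (existT T _); apply: sig_val_inj => /=.
by congr (op s _); apply: funext => k; apply: ls_map_irr.
Qed.

End LallementSum.

Section LallementArr.
Context (X Y : lsys_obj) (f : lsys_arr X Y).
Local Notation t := (sval (la_base f)).

Definition lall_fun (x : lallement_sum X) : lallement_sum Y :=
  existT (fun p => ls_A Y p : Type) (t (projT1 x))
    (exist _ (la_fib f (projT1 x) (sval (projT2 x)))
       (lh_mem (la_fib f) (svalP (projT2 x)))).

Lemma lall_funP n (s : Sg n) (x : 'I_n -> lallement_sum X) :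
  lall_fun (op s x) = op s (fun k => lall_fun (x k)).
Proof.
have e : t (op s (fun k => projT1 (x k))) =
  op s (fun k => projT1 (lall_fun (x k))) by rewrite homP.
transitivity (existT (fun p => ls_A Y p : Type) _
  (exist _ _ (@ls_closed _ Y n s (fun k => projT1 (lall_fun (x k))) _ e
     (fun k => projT2 (lall_fun (x k)))))); last exact: lall_opE.
congr (existT _ _); apply: sig_val_inj => /=.
apply: etrans (homP (la_fib f _) s _) _; congr (op s _); apply: funext => k.
by rewrite lh_natural /=; apply: ls_map_irr.
Qed.

Definition lallement_arr : over_arr (lallement_obj X) (lallement_obj Y) :=
  @OverArr (lallement_obj X) (lallement_obj Y) (la_base f)
    (Hom lall_funP) (fun _ => erefl).

End LallementArr.

Lemma lall_eq (X : lsys_obj) (i : lo_base X) (a b : ls_A X i) :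
  sval a = sval b ->
  existT (fun i => ls_A X i : Type) i a = existT (fun i => ls_A X i : Type) i b.
Proof. by move=> /sig_val_inj ->. Qed.

Definition Lallement : functor IntNPI_Lsys IntNPI_Over.
Proof.
refine (@Functor IntNPI_Lsys IntNPI_Over lallement_obj lallement_arr _ _).
- move=> X; apply: over_arr_eq => //; apply: hom_eq => -[i a].
  exact: lall_eq.
- move=> X Y Z g f; apply: over_arr_eq => //; apply: hom_eq => -[i a].
  exact: lall_eq.
Defined.

End Npi.

Section GFunctor.
Context (Sg : signature) (hS : plural Sg).

Definition G_alg (I : semilattice) : algebra Sg :=
  @Algebra Sg I (@sl_op Sg hS I) (sl_inh I).

Lemma G_leP (I : semilattice) (i j : G_alg I) :
  alg_le i j <-> ((i : I) <= (j : I))%O.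
Proof.
split=> [|le_ij].
  elim=> [b a [n [s [x [k [-> ->]]]]]|a|a b c _ h1 _ h2] //.
  - exact: sl_op_ub.
  - exact: le_trans h1 h2.
have [_ [n n2 [s]]] := hS.
have n0 : 0 < n by exact: leq_trans n2.
pose x (k : 'I_n) : G_alg I := if k == Ordinal n0 then i else j.
have e : j = op s x.
  apply/eqP; rewrite eq_le; apply/andP; split.
    have := sl_op_ub hS s x (Ordinal n2).
    by rewrite {1}/x -val_eqE.
  by apply/sl_op_le => k; rewrite /x; case: ifP.
by have := alg_le_op e (Ordinal n0); rewrite {1}/x eqxx.
Qed.

Definition G_obj (I : semilattice) : npi_alg Sg.
Proof.
refine (@NpiAlg Sg (G_alg I) _ _).
- move=> n s i /=; apply/eqP; rewrite eq_le; apply/andP; split.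
    exact/sl_op_le.
  case: n s => [|n] s; first by case: (hS.1 s).
  exact: (sl_op_ub hS s (fun=> i) ord0).
- move=> n s x y h; apply/G_leP; apply/sl_op_le => k.
  by apply: le_trans (sl_op_ub hS s y k); apply/G_leP.
Defined.

Definition G_hom (I P : semilattice) (xi : sl_hom I P) :
  hom (G_alg I) (G_alg P) :=
  @Hom Sg (G_alg I) (G_alg P) xi (@sl_op_morph Sg hS I P xi).

Definition G_arr (I P : Sl_s) (xi : arr I P) :
  @arr (NPIAlg_s Sg) (G_obj I) (G_obj P) :=
  exist _ (G_hom (sval xi)) (svalP xi).

Definition G : functor Sl_s (NPIAlg_s Sg).
Proof.
refine (@Functor Sl_s (NPIAlg_s Sg) G_obj G_arr _ _).
- by move=> I; apply: sig_val_inj; apply: hom_eq.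
- by move=> I J K g f; apply: sig_val_inj; apply: hom_eq.
Defined.

Definition G_map (I : semilattice) (A : isys Sg I) (i j : I)
  (h : @alg_le Sg (G I) i j) : hom (full_subalgebra (A i)) (A j) :=
  @Hom Sg (full_subalgebra (A i)) (A j)
    (fun a => is_map A ((G_leP i j).1 h) (sval a))
    (fun n s x => homP (is_map A ((G_leP i j).1 h)) s (fun k => sval (x k))).

Definition G_lsys (I : semilattice) (A : isys Sg I) : lsys (G I).
Proof.
refine (@LSys Sg (G I) (fun i : I => A i) (fun i : I => full_subalgebra (A i))
  (@G_map I A) (fun _ _ _ _ _ _ => Logic.I) _ _).
- move=> n s ii i e a j hij /=; rewrite homP.
  by congr (op s _); apply: funext => k; apply: is_map_comp.
- by move=> i h a; apply: is_map_id.
Defined.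

Definition IntG_obj (X : isys_obj Sg) : lsys_obj Sg :=
  LsysObj (G_lsys X).

Definition IntG_base (X Y : IntSls_Isys Sg) (f : arr X Y) :
  @arr Sl_s (io_base X) (io_base Y) :=
  exist _ (ia_base (sval f)) (svalP f).

Definition IntG_arr (X Y : IntSls_Isys Sg) (f : arr X Y) :
  lsys_arr (IntG_obj X) (IntG_obj Y).
Proof.
refine (@LsysArr Sg (IntG_obj X) (IntG_obj Y) (farr G (IntG_base f))
  (@LsysHom Sg (G (io_base X)) (G_lsys X)
     (lsys_reindex (sval (farr G (IntG_base f))) (G_lsys Y))
     (fun i : io_base X => ia_fib (sval f) i) (fun _ _ h => h) _)).
move=> i j h a /=; rewrite ih_natural /=.
by congr (is_map _ _ _); apply: Prop_irrelevance.
Defined.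

Definition IntG_eta : functor (IntSls_Isys Sg) (IntNPI_Lsys Sg).
Proof.
refine (@Functor (IntSls_Isys Sg) (IntNPI_Lsys Sg) IntG_obj IntG_arr _ _).
- by move=> X; apply: lsys_arr_eq.
- by move=> X Y Z g f; apply: lsys_arr_eq.
Defined.

End GFunctor.

(* Main.v *)
Require Import Defs.
From mathcomp Require Import all_boot all_order.
From mathcomp Require Import boolp.

Set Implicit Arguments.
Unset Strict Implicit.
Unset Printing Implicit Defensive.

Import Order.TTheory.

(** In a Plonka sum, [(x, i)] and [(y, j)] are related by [Phi] iff
    [i <= j] and [j <= i]. Hence the projection [(x, i) |-> i] onto the
    semilattice induces an isomorphism from the quotient by [Phi], and it
    commutes with all morphisms because these act on indices through their
    semilattice part. *)

(** Arrows of [Alg_s] are surjective, so an injective one is bijective; its inverse, obtained by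
    choice, is again a homomorphism. *)
Lemma Alg_s_iso (Sg : signature) (A B : Alg_s Sg) (f : arr A B) :
  injective (sval f : hom A B) -> is_iso f.
Proof.
case: f => f f_surj /= f_inj.
have [g fgK] := choice f_surj.
have gfK x : g (f x) = x by apply: f_inj; rewrite fgK.
have gP n (s : Sg n) (y : 'I_n -> B) : g (op s y) = op s (fun k => g (y k)).
  by apply: f_inj; rewrite homP fgK; congr (op s _); apply: funext => k.
exists (exist _ (Hom gP) (fun x => ex_intro _ (f x) (gfK x))).
by split; apply: sig_val_inj; apply: hom_eq => x /=.
Qed.

Section IndexIsomorphism.
Context (Sg : signature) (hS : plural Sg).

Lemma Phi_plonkaP (X : isys_obj Sg) (x y : plonka_obj hS X) :
  Phi x y <-> projT1 x = projT1 y.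
Proof.
case: x y => [i x] [j y]; split => /= [[/(f_equal (@projT1 _ _)) /= eij
  /(f_equal (@projT1 _ _)) /= eji]|e].
  (* Comparing indices in the two equations of [Phi] shows that [i] and [j] both equal their
     join. *)
  by rewrite -eij joinC.
(* Over a single index [plonka_D] keeps its left argument, as the transition map is the identity. *)
by subst j; split; apply: tag_map_id; rewrite /= joinxx.
Qed.

(** Read off a chosen representative; [plonka_indexE] shows that the choice is immaterial. *)
Definition plonka_index (X : isys_obj Sg) (c : quot_alg (plonka_obj hS X)) :
  G_alg hS (io_base X) := projT1 (qrepr c).

Lemma plonka_indexE (X : isys_obj Sg) (x : plonka_obj hS X) :
  plonka_index (qclass x) = projT1 x.
Proof. by apply/Phi_plonkaP; apply: qreprP. Qed.

(** By definition, [op s c] is the class of [op s] on representatives, and [plonka_op] acts on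
    indices by [sl_op]. *)
Lemma plonka_indexP (X : isys_obj Sg) n (s : Sg n)
  (c : 'I_n -> quot_alg (plonka_obj hS X)) :
  plonka_index (op s c) = op s (fun k => plonka_index (c k)).
Proof. exact: plonka_indexE. Qed.

Lemma plonka_index_inj (X : isys_obj Sg) : injective (@plonka_index X).
Proof.
by move=> c d e; rewrite -[c]qreprK -[d]qreprK; apply/qclassP/Phi_plonkaP.
Qed.

Lemma plonka_index_surj (X : isys_obj Sg) : surjective (@plonka_index X).
Proof.
move=> i; case: (algebra_inh (X i)) => x.
by exists (qclass (existT _ i x : plonka_obj hS X)); rewrite plonka_indexE.
Qed.

Definition plonka_index_arr (X : isys_obj Sg) :
  @arr (Alg_s Sg) (quot_alg (plonka_obj hS X)) (G_alg hS (io_base X)) :=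
  exist _ (Hom (@plonka_indexP X)) (@plonka_index_surj X).

(** By definition, [quot_hom] takes the class of the image of a representative, and [plonka_arr]
    moves its index by [ia_base f]. *)
Lemma plonka_index_natural (X Y : isys_obj Sg) (f : isys_arr X Y)
  (c : quot_alg (plonka_obj hS X)) :
  plonka_index (quot_hom (plonka_arr hS f) c) = ia_base f (plonka_index c).
Proof. exact: plonka_indexE. Qed.

Lemma plonka_index_arr_iso (X : isys_obj Sg) : is_iso (plonka_index_arr X).
Proof. by apply: Alg_s_iso; apply: plonka_index_inj. Qed.

End IndexIsomorphism.

Theorem proposition7p13 (Sg : signature) (hS : plural Sg) :
  (exists theta : nat_trans (P_qs Sg \oF Pl_qs hS)
                            (Q Sg \oF Lallement Sg \oF IntG_eta hS),
     is_nat_iso theta)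
  /\
  (exists theta : nat_trans (P Sg \oF Pl_s hS)
                            (Q Sg \oF Lallement Sg \oF IntG_eta hS
                               \oF IntSls_Isys_Pl_incl hS),
     is_nat_iso theta).
Proof.
split.
- unshelve eexists (@NatTrans _ _ (P_qs Sg \oF Pl_qs hS)
    (Q Sg \oF Lallement Sg \oF IntG_eta hS) (plonka_index_arr hS) _).
    move=> X Y f; apply: sig_val_inj; apply: hom_eq => c.
    exact: (plonka_index_natural (sval f) c).
  by move=> X; apply: plonka_index_arr_iso.
(* The same components serve: the underlying homomorphisms are unchanged, only the class of source
   arrows is smaller. *)
- unshelve eexists (@NatTrans _ _ (P Sg \oF Pl_s hS)
    (Q Sg \oF Lallement Sg \oF IntG_eta hS \oF IntSls_Isys_Pl_incl hS)
    (plonka_index_arr hS) _).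
    move=> X Y f; apply: sig_val_inj; apply: hom_eq => c.
    exact: (plonka_index_natural (sval f) c).
  by move=> X; apply: plonka_index_arr_iso.
Qed.
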